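(* Let $d\ge 3$, let $\mathbb{T}_{d-1,d}$ be the infinite rooted tree whose root $\rho$ has degree $d-1$ and in which every other vertex has degree $d$, and let $G$ be a graph containing an infinite ray $0,1,2,\ldots$. Consider first passage percolation on $\mathbb{T}_{d-1,d}\times G$ with i.i.d. edge weights distributed as a random variable $X\ge 0$ with $\mathbf{E}[X]<\infty$, and let $D(n)=d_X((\rho,0),(\rho,n))$ be the first passage percolation distance between $(\rho,0)$ and $(\rho,n)$. Then the sequence of random variables $D(n)-\mathbf{E}[D(n)]$ is tight in $n$.
   Context: An infinite ray $0,1,2,\ldots$ in $G$ is a sequence of distinct vertices of $G$, denoted $0,1,2,\ldots$, with $j$ and $j+1$ adjacent for every $j\ge 0$. The product $\mathbb{T}\times G$ is the Cartesian product graph: its vertices are pairs $(v,g)$ with $v$ a vertex of $\mathbb{T}$ and $g$ a vertex of $G$, and $(v,g)$, $(v',g')$ are adjacent iff either $v=v'$ and $g,g'$ are adjacent in $G$, or $g=g'$ and $v,v'$ are adjacent in $\mathbb{T}$. First passage percolation: to each edge $e$ of the graph attach a random variable $X_e$, all $X_e$ being independent copies of a random variable $X\ge 0$ with $\mathbf{E}[X]<\infty$. For a (finite) path $\gamma$, $|\gamma|_X=\sum_{e\in\gamma}X_e$. The random (pseudo-)metric is $$d_X(v,w)=\inf\{|\gamma|_X : \gamma \text{ is a path from } v \text{ to } w\}.$$ A sequence of real random variables $(Z_n)$ is tight if for every $\eta>0$ there is $M<\infty$ with $\mathbf{P}(|Z_n|>M)\le\eta$ for all $n$.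
   Formalization: Every vertex of G is assumed to have at most countably many neighbours; with uncountable degrees D(n) is an infimum over uncountably many paths, need not be measurable, and the claim can fail after changing each weight on a null set. *)

(* Defs.v *)
From HB Require Import structures.
From mathcomp Require Import all_boot all_order all_algebra.
From mathcomp Require Import all_classical all_reals all_analysis.

Set Implicit Arguments.
Unset Strict Implicit.
Unset Printing Implicit Defensive.

Import Order.TTheory GRing.Theory Num.Theory.
Import numFieldNormedType.Exports.

Local Open Scope classical_set_scope.
Local Open Scope ring_scope.

(* Simple undirected graphs, possibly infinite. *)
Record graph := Graph {
  vertex :> choiceType;
  adj : rel vertex;
  adj_sym : symmetric adj;
  adj_irrefl : irreflexive adj }.

(* Edges are unordered pairs of adjacent vertices. *)
Definition edges (G : graph) : set (set G) :=
  [set e | exists v w : G, adj v w /\ e = [set v; w]].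

(* Locally finite graphs and graphs with countably many vertices are both
   locally countable. *)
Definition locally_countable (G : graph) : Prop :=
  forall v : G, countable [set w | adj v w].

Definition is_ray (G : graph) (r : nat -> G) : Prop :=
  injective r /\ forall j, adj (r j) (r j.+1).

(* The sequence v :: p is a path (without repeated vertices) from v to w. *)
Definition is_path (G : graph) (v w : G) (p : seq G) : Prop :=
  [/\ path (@adj G) v p, last v p = w & uniq (v :: p)].

(* The vertices are the words over d - 1 letters; the root is the empty word
   and the children of u are the d - 1 words i :: u, so that the parent of a
   nonempty word v is behead v. *)
Definition tree_adj (d : nat) : rel (seq 'I_d.-1) := fun u v =>
  (u != [::]) && (v == behead u) || (v != [::]) && (u == behead v).

Lemma tree_adj_sym d : symmetric (@tree_adj d).
Proof. by move=> u v; rewrite /tree_adj orbC. Qed.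

Lemma tree_adj_irrefl d : irreflexive (@tree_adj d).
Proof.
move=> [|i u] //=; rewrite /tree_adj orbb /=.
by apply/negP => /eqP /(congr1 size) /= /eqP; rewrite -[_ == _]/(_.+1 == _) gtn_eqF.
Qed.

Definition tree (d : nat) : graph :=
  Graph (@tree_adj_sym d) (@tree_adj_irrefl d).

Definition tree_root (d : nat) : tree d := [::] : seq 'I_d.-1.

Definition cprod_adj (G H : graph) : rel (G * H) := fun x y =>
  (x.1 == y.1) && adj x.2 y.2 || (x.2 == y.2) && adj x.1 y.1.

Lemma cprod_adj_sym G H : symmetric (@cprod_adj G H).
Proof.
move=> x y; rewrite /cprod_adj (eq_sym x.1) (eq_sym x.2).
by rewrite (adj_sym x.1) (adj_sym x.2).
Qed.

Lemma cprod_adj_irrefl G H : irreflexive (@cprod_adj G H).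
Proof. by move=> x; rewrite /cprod_adj !adj_irrefl !andbF. Qed.

Definition cprod (G H : graph) : graph :=
  Graph (@cprod_adj_sym G H) (@cprod_adj_irrefl G H).

Section FirstPassagePercolation.
Variables (R : realType) (G : graph).

(* Edge weights x are functions on all sets of vertices; only their values on
   edges of G matter. *)
Definition path_weight (x : set G -> R) (v : G) (p : seq G) : R :=
  \sum_(t <- pairmap (fun a b => x [set a; b]) v p) t.

(* If v and w are not connected this infimum is 0 instead of +oo; for weights
   that are not nonnegative it need not be meaningful. *)
Definition fpp_dist (x : set G -> R) (v w : G) : R :=
  inf [set path_weight x v p | p in [set p | is_path v w p]].

End FirstPassagePercolation.

Section Probability.
Variables (R : realType) (disp : measure_display) (T : measurableType disp).
Variable P : probability T R.

(* Mutual independence of the random variables X i, for i in D. *)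
Definition mutually_independent (I : choiceType) (D : set I)
    (X : I -> {RV P >-> R}) : Prop :=
  forall (s : seq I) (B : I -> set R),
    uniq s -> [set` s] `<=` D -> (forall i, measurable (B i)) ->
    P (\bigcap_(i in [set` s]) (X i @^-1` B i)) =
    (\prod_(i <- s) P (X i @^-1` B i))%E.

(* Measures are only meaningful on measurable sets, hence the restriction. *)
Definition same_law (disp' : measure_display) (T' : measurableType disp')
    (P' : probability T' R) (X : {RV P >-> R}) (Y : {RV P' >-> R}) : Prop :=
  forall A : set R, measurable A -> distribution P X A = distribution P' Y A.

Definition tight (Z : nat -> T -> R) : Prop :=
  forall eta : R, 0 < eta ->
    exists M : R, forall n, (P [set t | (M < `|Z n t|)%R] <= eta%:E)%E.

End Probability.

(* Main.v *)
Require Import Defs.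
From HB Require Import structures.
From mathcomp Require Import all_boot all_order all_algebra.
From mathcomp Require Import all_classical all_reals all_analysis.
From mathcomp Require Import measurable_realfun lra.

Set Implicit Arguments.
Unset Strict Implicit.
Unset Printing Implicit Defensive.

Import Order.TTheory GRing.Theory Num.Theory.
Import numFieldNormedType.Exports.

Local Open Scope classical_set_scope.
Local Open Scope ring_scope.

(** The proof is the Dekking-Host argument.  Each child of the root of the tree
is itself the root of a copy of the tree.  For two distinct children, the
distances [D1] and [D2] between the levels [0] and [n] of the ray, measured
inside the corresponding copies of the product graph, are independent and have
the law of [D(n)], because they are the same function of disjoint families of
i.i.d. weights.  Going from the root to one of the children, crossing its copy
and coming back gives [D(n) <= min(D1, D2) + W], where [W] is the total weight
of the four edges used to enter and leave the copies; so [E W = 4 E X], whatever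
[n] is ([fpp_dist_detour]).

If [D(n)] had large fluctuations, then [min(D1, D2)] would typically be much
smaller than [D(n)].  Quantitatively, let [c = E D(n)].  The gap
[D1 - min(D1, D2)] is at least the sum of [(D1 - c)^+ 1(D2 <= c)] and of
[(c - D2)^+ 1(D1 > c)].  By independence these two terms have expectations
[P(D(n) <= c) m] and [P(D(n) > c) m] with
[m = E (D(n) - c)^+ = E (c - D(n))^+], which add up to [m].  Hence [m <= E W]
and [E |D(n) - c| = 2 m <= 8 E X] ([dekking_host]), and Markov's inequality
concludes.

The rest is measure theory.  Configurations of weights carry the sigma-algebra
generated by the finite-dimensional cylinders on edges; by Dynkin's theorem,
mutual independence gives the joint law of the two families of weights on that
sigma-algebra ([sample_indep]), and the distance is measurable because local
countability leaves only countably many paths ([measurable_fpp_dist]).  The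
weights have the law of a nonnegative variable but may be negative on a null
set, so that the inequalities between distances only hold almost surely. *)

(** * Countable families, infima and tightness *)

Lemma countable_image S T (f : S -> T) (A : set S) :
  countable A -> countable (f @` A).
Proof. by apply: sub_countable; exact: card_image_le. Qed.

(** Both sides take the default value 0 when the infimum is infinite; this turns
the measurability of a real infimum, for which no lower bound is available,
into that of an extended real one. *)
Lemma inf_fine (R : realType) (A : set R) :
  inf A = fine (ereal_inf (EFin @` A)).
Proof.
have [->|/set0P A0] := eqVneq A set0.
  by rewrite inf0 image_set0 ereal_inf0.
have [lbA|nlbA] := pselect (has_lbound A); first by rewrite ereal_inf_EFin.
rewrite inf_out; last by case.
suff -> : ereal_inf (EFin @` A) = -oo%E by [].
apply: contrapT => infNy; apply: nlbA.
have : (ereal_inf (EFin @` A) < +oo)%E.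
  case: A0 => a Aa; apply: le_lt_trans (ltry a).
  by apply: ereal_inf_lbound; exists a.
case infE : (ereal_inf _) infNy => [r| |]// _ _.
by exists r => a Aa; rewrite -lee_fin -infE; apply: ereal_inf_lbound; exists a.
Qed.

Lemma countable_bigcup_measurable d (T : measurableType d) J (D : set J)
    (F : J -> set T) : countable D ->
  (forall j, D j -> measurable (F j)) -> measurable (\bigcup_(j in D) F j).
Proof.
move=> /countable_injP[f finj] mF.
rewrite (_ : \bigcup_(j in D) F j =
    \bigcup_n (\bigcup_(j in [set j | D j /\ f j = n]) F j)); last first.
  apply/seteqP; split => [t [j Dj Fjt]|t [n _ [j [Dj _] Fjt]]].
    by exists (f j) => //; exists j.
  by exists j.
apply: bigcupT_measurable => n.
have [[j [Dj fj]]|none] := pselect (exists j, D j /\ f j = n).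
  rewrite (_ : [set _ | _] = [set j]); first by rewrite bigcup_set1; exact: mF.
  apply/seteqP; split => [i [Di fi]|_ ->//].
  by apply: finj; rewrite ?inE// fi.
rewrite (_ : [set _ | _] = set0) ?bigcup_set0//.
by apply/seteqP; split => // j Dj; case: none; exists j.
Qed.

Lemma measurable_fun_ereal_inf_countable d (T : measurableType d) J
    (R : realType) (D : set J) (f : J -> T -> \bar R) : countable D ->
  (forall j, D j -> measurable_fun setT (f j)) ->
  measurable_fun setT (fun t => ereal_inf ((f^~ t) @` D)).
Proof.
move=> cD mf.
apply: (measurability _ (ErealGenInftyO.measurableE R)) => //.
move=> _ [_ [r ->] <-]; rewrite setTI.
rewrite (_ : _ @^-1` _ = \bigcup_(j in D) (f j @^-1` `]-oo, r%:E[)).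
  apply: countable_bigcup_measurable => // j Dj.
  by rewrite -[_ @^-1` _]setTI; apply: mf => //; exact: emeasurable_itv.
apply/seteqP; split => t /=; rewrite in_itv/=.
  by move=> /ereal_inf_lt[_ [j Dj <-] fr]; exists j => //=; rewrite in_itv.
move=> [j Dj] /=; rewrite in_itv/= => fr.
by apply: le_lt_trans fr; apply: ereal_inf_lbound; exists j.
Qed.

Section Tightness.
Context (R : realType) (disp : measure_display) (T : measurableType disp).
Variable P : probability T R.

Lemma tight_bounded_expectation (Z : nat -> T -> R) (K : R) :
  (forall n, measurable_fun setT (Z n)) ->
  (forall n, 'E_P[fun t => (`|Z n t|)%R] <= K%:E)%E -> tight P Z.
Proof.
move=> mZ ZK eta eta0.
have K0 : 0 <= K.
  by rewrite -lee_fin; apply: le_trans (ZK 0%N); exact: expectation_ge0.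
pose M := K / eta + 1.
have M0 : 0 < M by rewrite ltr_wpDl// divr_ge0// ltW.
exists M => n; set A := [set t | _].
have mnZ : measurable_fun setT (fun t => `|Z n t|) by exact: measurableT_comp.
have mA : measurable A.
  rewrite (_ : A = (fun t => `|Z n t|) @^-1` `]M, +oo[%classic).
    by rewrite -[_ @^-1` _]setTI; apply: mnZ => //; exact: measurable_itv.
  by apply/seteqP; split => t; rewrite /A /= in_itv/= andbT.
have mnZE : measurable_fun setT (fun t => (`|Z n t|)%:E).
  exact/measurable_EFinP.
have MA : (M%:E * P A <= K%:E)%E.
  apply: le_trans (ZK n); rewrite unlock -integral_cst//.
  apply: (@le_trans _ _ (\int[P]_(t in A) (`|Z n t|)%:E)%E).
    apply: ge0_le_integral => //.
    - by move=> t _; rewrite lee_fin ltW.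
    - by apply: measurable_funS mnZE.
    - by move=> t; rewrite /A /= lee_fin => /ltW.
  by apply: ge0_subset_integral => // t _; rewrite lee_fin.
have PA : P A \is a fin_num by exact: fin_num_measure.
rewrite -(fineK PA) -EFinM lee_fin in MA.
rewrite -(fineK PA) lee_fin -(ler_pM2l M0) (le_trans MA)//.
by rewrite /M mulrDl mul1r mulfVK ?gt_eqF// lerDl ltW.
Qed.

Lemma ae_countable J (D : set J) (Q : J -> T -> Prop) : countable D ->
  (forall j, D j -> {ae P, forall t, Q j t}) ->
  {ae P, forall t, forall j, D j -> Q j t}.
Proof.
move=> /countable_injP[f finj] aeQ.
have : {ae P, forall t n, forall j, D j -> f j = n -> Q j t}.
  apply/ae_foralln => n.
  have [[j [Dj fj]]|none] := pselect (exists j, D j /\ f j = n).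
    apply: filterS (aeQ j Dj) => t Qjt i Di fi.
    by have -> : i = j by apply: finj; rewrite ?inE// fi.
  by apply: aeW => t j Dj fj; case: none; exists j.
by apply: filterS => t Qt j Dj; exact: (Qt (f j)).
Qed.

End Tightness.

(** * The Dekking-Host inequality *)

Section DekkingHost.
Context (R : realType) (d : measure_display) (T : measurableType d).
Variable P : probability T R.
Implicit Types Z : T -> R.

(** Besides independence, this forces [Z1] and [Z2] to have the law of [Z]: take
[A] or [B] to be the whole line. *)
Definition independent_copies (Z Z1 Z2 : T -> R) : Prop :=
  forall A B : set R, measurable A -> measurable B ->
    P (Z1 @^-1` A `&` Z2 @^-1` B) = (P (Z @^-1` A) * P (Z @^-1` B))%E.

Lemma independent_copies_sym Z Z1 Z2 :
  independent_copies Z Z1 Z2 -> independent_copies Z Z2 Z1.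
Proof. by move=> h A B mA mB; rewrite setIC h// muleC. Qed.

Lemma independent_copies_law Z Z1 Z2 (A : set R) :
  independent_copies Z Z1 Z2 -> measurable A ->
  P (Z1 @^-1` A) = P (Z @^-1` A).
Proof.
move=> h mA; have := h A setT mA measurableT.
by rewrite !preimage_setT setIT probability_setT mule1.
Qed.

Lemma integral_law (Z Z' : T -> R) (f : R -> \bar R) :
  measurable_fun setT Z -> measurable_fun setT Z' ->
  (forall A : set R, measurable A -> P (Z' @^-1` A) = P (Z @^-1` A)) ->
  measurable_fun [set: R] f -> (forall x, 0 <= f x)%E ->
  (\int[P]_t f (Z' t) = \int[P]_t f (Z t))%E.
Proof.
move=> mZ mZ' law mf f0.
have transfer U : measurable_fun setT U ->
    (\int[P]_t f (U t) = \int[pushforward P U]_y f y)%E.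
  by move=> mU; rewrite [RHS]ge0_integral_pushforward// preimage_setT.
rewrite (transfer _ mZ) (transfer _ mZ').
by apply: eq_measure_integral => A mA _; exact: law.
Qed.

(** Independence makes the law of [Z1] under [P] restricted to the event
[Z2 \in B] a multiple of the law of [Z]. *)
Lemma integral_indep Z Z1 Z2 (f : R -> \bar R) (B : set R) :
  measurable_fun setT Z -> measurable_fun setT Z1 -> measurable_fun setT Z2 ->
  independent_copies Z Z1 Z2 -> measurable_fun [set: R] f ->
  (forall x, 0 <= f x)%E -> measurable B ->
  (\int[P]_(t in Z2 @^-1` B) f (Z1 t) = P (Z @^-1` B) * \int[P]_t f (Z t))%E.
Proof.
move=> mZ mZ1 mZ2 ind mf f0 mB.
have mC : measurable (Z2 @^-1` B) by rewrite -[_ @^-1` _]setTI; exact: mZ2.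
have mC' : measurable (Z @^-1` B) by rewrite -[_ @^-1` _]setTI; exact: mZ.
have fPB : P (Z @^-1` B) \is a fin_num by rewrite fin_num_measure.
have k0 : 0 <= fine (P (Z @^-1` B)) by rewrite fine_ge0.
have transfer (m : {measure set T -> \bar R}) U : measurable_fun setT U ->
    (\int[m]_t f (U t) = \int[pushforward m U]_y f y)%E.
  by move=> mU; rewrite [RHS]ge0_integral_pushforward// preimage_setT.
rewrite (transfer _ _ mZ) -[in RHS](fineK fPB).
have -> : fine (P (Z @^-1` B)) = (NngNum k0)%:num by [].
rewrite -ge0_integral_mscale//.
transitivity (\int[mrestr P mC]_t f (Z1 t))%E.
  rewrite [RHS](@ge0_negligible_integral _ _ _ _ setT (~` (Z2 @^-1` B)))//.
  - rewrite setTD setCK; apply: eq_measure_integral => A _ AC.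
    by rewrite /= /mrestr (setIidl AC).
  - exact: measurableC.
  - exact: measurableT_comp.
  - by rewrite /= /mrestr setICl measure0.
rewrite transfer//.
apply: eq_measure_integral => A mA _.
by rewrite /= /mscale/= fineK// /pushforward /mrestr ind// muleC.
Qed.

(** The pointwise form of the bound on the gap between [z1] and the minimum.  It
is the inequality
[z + (z1 - c)^+ 1(z2 <= c) + (c - z2)^+ 1(c < z1) <= z1 + w],
with [z] and [z1] split into positive and negative parts around [c].  All the
terms other than [w] are then nonnegative, and their integrals add up without
any integrability of [z1] and [z2]. *)
Lemma min_excess (z z1 z2 w c : R) : z <= Num.min z1 z2 + w ->
  let p x := Num.max (x - c) 0 in let n x := Num.max (- (x - c)) 0 in
  p z + n z1 +
    ((if z2 <= c then p z1 else 0) + (if c < z1 then n z2 else 0)) <=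
  p z1 + n z + w.
Proof.
move=> zle /=.
have pnE x : Num.max (x - c) 0 - Num.max (- (x - c)) 0 = x - c.
  by have [|] := leP (x - c) 0; have [|] := leP (- (x - c)) 0; lra.
have := pnE z; have := pnE z1.
have [zz1 zz2] : z <= z1 + w /\ z <= z2 + w.
  by split; rewrite (le_trans zle)// lerD2r ge_min lexx ?orbT.
set pz := Num.max (z - c) 0; set nz := Num.max (- (z - c)) 0.
set pz1 := Num.max (z1 - c) 0; set nz1 := Num.max (- (z1 - c)) 0.
case: ifPn => [z2c|/negbTE z2c]; case: ifPn => [z1c|]; rewrite -?leNgt.
- have -> : pz1 = z1 - c by rewrite /pz1 max_l// subr_ge0 ltW.
  have -> : Num.max (- (z2 - c)) 0 = c - z2.
    by rewrite max_l opprB// subr_ge0.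
  lra.
- move=> z1c; have -> : pz1 = 0 by rewrite /pz1 max_r// subr_le0.
  lra.
- have -> : Num.max (- (z2 - c)) 0 = 0.
    by rewrite max_r// oppr_le0 subr_ge0 ltW// ltNge z2c.
  lra.
- lra.
Qed.

(** Integrating [min_excess]: the expectations [m] of [(Z - c)^+] and [m'] of
[(Z - c)^-] agree since [c] is the mean of [Z], and they cancel against those
of [Z1], which leaves [m P(Z <= c) + m P(Z > c) <= E W]. *)
Lemma dekking_host Z Z1 Z2 (W : T -> R) :
  P.-integrable setT (EFin \o Z) ->
  measurable_fun setT Z1 -> measurable_fun setT Z2 -> measurable_fun setT W ->
  independent_copies Z Z1 Z2 -> (forall t, 0 <= W t) ->
  {ae P, forall t, Z t <= Num.min (Z1 t) (Z2 t) + W t} ->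
  ('E_P[fun t => (`|Z t - fine 'E_P[Z]|)%R] <= 2%:E * 'E_P[W])%E.
Proof.
move=> iZ mZ1 mZ2 mW ind W0 leZ.
have mZ : measurable_fun setT Z by exact/measurable_EFinP/measurable_int/iZ.
set c := fine _.
have cE : ('E_P[Z] = c%:E)%E.
  by rewrite /c fineK// unlock; exact: integrable_fin_num.
pose F (x : R) := (x - c)%:E.
have mF : measurable_fun [set: R] F.
  apply/measurable_EFinP; exact: measurable_funB.
have mFp : measurable_fun [set: R] (F^\+)%E by exact: measurable_funepos.
have mFn : measurable_fun [set: R] (F^\-)%E by exact: measurable_funeneg.
have Fp0 x : (0 <= F^\+ x)%E by exact: funepos_ge0.
have Fn0 x : (0 <= F^\- x)%E by exact: funeneg_ge0.
pose A := [set x : R | c < x].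
pose B := [set x : R | x <= c].
have mA : measurable A.
  have -> : A = `]c, +oo[%classic.
    by apply/seteqP; split => x; rewrite /A /= in_itv/= andbT.
  exact: measurable_itv.
have mB : measurable B.
  have -> : B = `]-oo, c]%classic.
    by apply/seteqP; split => x; rewrite /B /= in_itv.
  exact: measurable_itv.
have mZ1A : measurable (Z1 @^-1` A) by rewrite -[_ @^-1` _]setTI; exact: mZ1.
have mZ2B : measurable (Z2 @^-1` B) by rewrite -[_ @^-1` _]setTI; exact: mZ2.
have mZB : measurable (Z @^-1` B) by rewrite -[_ @^-1` _]setTI; exact: mZ.
have ZAE : Z @^-1` A = ~` (Z @^-1` B).
  by apply/seteqP; split => t; rewrite /A /B /=;
    [move/lt_geF->|move/negP; rewrite -ltNge].
have iF : P.-integrable setT (F \o Z).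
  have -> : F \o Z = ((EFin \o Z) \- cst c%:E)%E by [].
  by apply: integrableB => //; exact: finite_measure_integrable_cst.
have FpE : (F \o Z)^\+%E = (F^\+ \o Z)%E
  by apply/funext => t /=; rewrite !funeposE.
have FnE : (F \o Z)^\-%E = (F^\- \o Z)%E
  by apply/funext => t /=; rewrite !funenegE.
pose m := (\int[P]_t F^\+ (Z t))%E.
pose m' := (\int[P]_t F^\- (Z t))%E.
have mfin : m \is a fin_num.
  rewrite fin_num_abs gee0_abs.
    by have := integral_funepos_lt_pinfty measurableT iF; rewrite FpE.
  exact: integral_ge0.
have m'fin : m' \is a fin_num.
  rewrite fin_num_abs gee0_abs.
    by have := integral_funeneg_lt_pinfty measurableT iF; rewrite FnE.
  exact: integral_ge0.
have m'E : m' = m.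
  have : (\int[P]_t (F \o Z) t = 0)%E.
    have -> : F \o Z = ((EFin \o Z) \- cst c%:E)%E by [].
    rewrite integralB//; last exact: finite_measure_integrable_cst.
    have := expectation_cst P c; rewrite unlock => ->.
    by move: cE; rewrite unlock => ->; rewrite subee.
  rewrite integralE FpE FnE -/m -/m' -(fineK mfin) -(fineK m'fin) -EFinB.
  by move=> -[] /eqP; rewrite subr_eq0 => /eqP ->.
have absE : ('E_P[fun t => (`|Z t - c|)%R] = m + m')%E.
  rewrite unlock -ge0_integralD//; last 2 first.
  - exact: measurableT_comp mFp mZ.
  - exact: measurableT_comp mFn mZ.
  apply: eq_integral => t _.
  by have /(congr1 (fun f => f t)) /= := fune_abse (F \o Z); rewrite FpE FnE.
pose U := ((fun t => F^\+ (Z1 t)) \_ (Z2 @^-1` B))%E.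
pose V := ((fun t => F^\- (Z2 t)) \_ (Z1 @^-1` A))%E.
have key : {ae P, forall t, setT t ->
    (F^\+ (Z t) + F^\- (Z1 t) + (U t + V t) <=
     F^\+ (Z1 t) + F^\- (Z t) + (W t)%:E)%E}.
  apply: filterS leZ => t leZt _.
  have inB : (t \in Z2 @^-1` B) = (Z2 t <= c) by apply/idP/idP; rewrite inE.
  have inA : (t \in Z1 @^-1` A) = (c < Z1 t) by apply/idP/idP; rewrite inE.
  rewrite /U /V !patchE inA inB /F !funeposE !funenegE -!EFinN -!EFin_max.
  have /= := min_excess c leZt.
  by case: ifP => _; case: ifP => _; rewrite -!EFinD lee_fin.
have U0 t : (0 <= U t)%E by rewrite /U patchE; case: ifP.
have V0 t : (0 <= V t)%E by rewrite /V patchE; case: ifP.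
have mU : measurable_fun setT U.
  apply/(measurable_restrictT _ _).1 => //.
  by apply: measurable_funS (measurableT_comp mFp mZ1).
have mV : measurable_fun setT V.
  apply/(measurable_restrictT _ _).1 => //.
  by apply: measurable_funS (measurableT_comp mFn mZ2).
have UE : (\int[P]_t U t = P (Z @^-1` B) * m)%E.
  by rewrite -integral_mkcond (integral_indep mZ mZ1 mZ2 ind mFp Fp0 mB).
have VE : (\int[P]_t V t = P (Z @^-1` A) * m)%E.
  have ind' := independent_copies_sym ind.
  rewrite -integral_mkcond (integral_indep mZ mZ2 mZ1 ind' mFn Fn0 mA).
  by rewrite -/m' m'E.
have Z1E S : measurable S -> P (Z1 @^-1` S) = P (Z @^-1` S).
  exact: independent_copies_law ind.
have pE : (\int[P]_t F^\+ (Z1 t) = m)%E by exact: integral_law mFp Fp0.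
have nE : (\int[P]_t F^\- (Z1 t) = m)%E.
  by rewrite -m'E; exact: integral_law mFn Fn0.
have mpZ := measurableT_comp mFp mZ.
have mnZ := measurableT_comp mFn mZ.
have mpZ1 := measurableT_comp mFp mZ1.
have mnZ1 := measurableT_comp mFn mZ1.
have mWE : measurable_fun setT (fun t => (W t)%:E) by exact/measurable_EFinP.
have mEW : (m <= 'E_P[W])%E.
  have : (\int[P]_t (F^\+ (Z t) + F^\- (Z1 t) + (U t + V t)) <=
     \int[P]_t (F^\+ (Z1 t) + F^\- (Z t) + (W t)%:E))%E.
    apply: ae_ge0_le_integral => // [t _||t _|].
    - by rewrite !adde_ge0.
    - apply: emeasurable_funD; apply: emeasurable_funD => //.
    - by rewrite !adde_ge0// lee_fin.
    - by apply: emeasurable_funD => //; apply: emeasurable_funD.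
  rewrite ge0_integralD//=; last 4 first.
  - by move=> t _; rewrite adde_ge0.
  - exact: emeasurable_funD.
  - by move=> t _; rewrite adde_ge0.
  - exact: emeasurable_funD.
  rewrite [in X in (_ <= X)%E]ge0_integralD//=; last 3 first.
  - by move=> t _; rewrite adde_ge0.
  - exact: emeasurable_funD.
  - by move=> t _; rewrite lee_fin.
  rewrite !ge0_integralD//= pE nE UE VE -/m -/m' m'E.
  rewrite -ge0_muleDl// ZAE probability_setC//.
  rewrite [X in (X * m)%E]addeC subeK ?fin_num_measure// mul1e.
  rewrite -(fineK mfin) unlock -!EFinD.
  case: (\int[P]_t _)%E => [r| |]; rewrite ?lee_fin ?leey ?leeNy_eq//=.
  by lra.
by rewrite absE m'E -mule2n -mule_natl lee_pmul2l.
Qed.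

End DekkingHost.

(** * The law of a family of independent weights *)

Section Cylinders.
Context (R : realType) (I : choiceType).
Implicit Types (D : set I) (s : seq I) (B : I -> set R).

Definition cylinder s B : set (I -> R) :=
  \bigcap_(i in [set` s]) [set x | B i (x i)].

(** Mutual independence is about lists without repetitions. *)
Lemma cylinder_undup s B : cylinder s B = cylinder (undup s) B.
Proof.
by apply/seteqP; split => x xB i; have := xB i; rewrite /= mem_undup.
Qed.

Definition cylinders D : set (set (I -> R)) :=
  [set A | exists s B, [/\ [set` s] `<=` D, forall i, measurable (B i) &
                        A = cylinder s B]].

Lemma setI_closed_cylinders D : setI_closed (cylinders D).
Proof.
move=> _ _ [s [B [sD mB ->]]] [s' [B' [sD' mB' ->]]].
exists (s ++ s').
exists (fun i => (if i \in s then B i else setT) `&`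
                 (if i \in s' then B' i else setT)); split.
- by move=> i /=; rewrite mem_cat => /orP[/sD|/sD'].
- by move=> i; apply: measurableI; case: ifP.
- apply/seteqP; split => [x [Bx Bx'] i /=|x xB].
  + by move=> _; split; case: ifP => // ?; [exact: Bx|exact: Bx'].
  + split=> i /= si.
    * by have := xB i; rewrite /= mem_cat si => /(_ isT)[].
    * by have := xB i; rewrite /= mem_cat si orbT => /(_ isT)[].
Qed.

Lemma setT_cylinders D : cylinders D setT.
Proof.
exists [::], (fun=> setT); split => //.
by apply/esym/seteqP; split.
Qed.

Definition config D := g_sigma_algebraType (cylinders D).

Lemma measurable_coord D i : D i ->
  measurable_fun setT (fun x : config D => x i).
Proof.
move=> Di _ A mA; rewrite setTI; apply: sub_sigma_algebra.
exists [:: i], (fun=> A); split => //.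
- by move=> j /=; rewrite inE => /eqP ->.
- apply/seteqP; split => [x Ax j /=|x /(_ i)]; first by rewrite inE => /eqP ->.
  by apply; rewrite /= inE.
Qed.

End Cylinders.
Arguments cylinders R {I} D.
Arguments setT_cylinders R {I} D.

Section ProductLaw.
Context (R : realType) (I : choiceType) (D : set I).
Context (disp : measure_display) (T : measurableType disp).
Variables (P : probability T R) (Y : I -> {RV P >-> R}).

Definition sample (phi : I -> I) : T -> config R D := fun t i => Y (phi i) t.

Lemma sample_cylinder phi s (B : I -> set R) :
  sample phi @^-1` cylinder s B =
  \bigcap_(i in [set` s]) (Y (phi i) @^-1` B i).
Proof. by []. Qed.

Lemma measurable_sample phi : measurable_fun setT (sample phi).
Proof.
refine (@measurability _ _ T (config R D) setT (sample phi)
  (cylinders R D) _ _) => //.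
move=> _ [_ [s [B [sD mB ->]]] <-]; rewrite setTI sample_cylinder.
apply: fin_bigcap_measurable => //= i _.
by rewrite -[_ @^-1` _]setTI; exact: measurable_funP.
Qed.

(** Dynkin's theorem: two finite measures that agree on the cylinders, which are
stable under intersection, agree everywhere. *)
Lemma cylinder_ext (f g : T -> config R D) (C : set T) (k : \bar R) :
  measurable_fun setT f -> measurable_fun setT g -> measurable C ->
  k \is a fin_num ->
  (forall A, cylinders R D A -> P (f @^-1` A `&` C) = P (g @^-1` A) * k)%E ->
  forall A : set (config R D), measurable A ->
    P (f @^-1` A `&` C) = (P (g @^-1` A) * k)%E.
Proof.
move=> mf mg mC kfin fg A mA.
have k0 : 0 <= fine k.
  rewrite -lee_fin fineK//; have := fg _ (setT_cylinders _ _).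
  by rewrite !preimage_setT setTI probability_setT mul1e => <-.
have kE : k = (NngNum k0)%:num%:E by rewrite /= fineK.
rewrite muleC [in RHS]kE.
apply: (@g_sigma_algebra_measure_unique _ R (config R D) (cylinders R D) _
  (fun=> setT) _ _ (pushforward (mrestr P mC) f)
  (mscale (NngNum k0) (pushforward P g))) => //.
- by move=> B; exact: sub_sigma_algebra.
- by move=> _; exact: setT_cylinders.
- by rewrite bigcup_const.
- exact: setI_closed_cylinders.
- by move=> B cB; rewrite /= /pushforward /mrestr /mscale fg// muleC -kE.
- move=> _; rewrite /= /pushforward /mrestr preimage_setT setTI.
  by rewrite -ge0_fin_numE// fin_num_measure.
Qed.

Hypothesis Yindep : mutually_independent D Y.

(** Two relabellings with disjoint images produce independent families with the
law of the original one.  On cylinders this is mutual independence for the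
concatenation of the two relabelled lists of indices; [cylinder_ext], applied
to each family in turn, extends it to all events.  The left inverses [psi1] and
[psi2] serve to transport the constraints of the cylinders along the
relabellings. *)
Lemma sample_indep (phi1 phi2 psi1 psi2 : I -> I) :
  (forall i, D i -> D (phi1 i)) -> (forall i, D i -> D (phi2 i)) ->
  cancel phi1 psi1 -> cancel phi2 psi2 ->
  (forall i j, D i -> D j -> phi1 i <> phi2 j) ->
  (forall i j (B : set R), D i -> D j -> measurable B ->
    P (Y i @^-1` B) = P (Y j @^-1` B)) ->
  forall A B : set (config R D), measurable A -> measurable B ->
    P (sample phi1 @^-1` A `&` sample phi2 @^-1` B) =
    (P (sample id @^-1` A) * P (sample id @^-1` B))%E.
Proof.
move=> D1 D2 K1 K2 disj law.
have cyl phi psi s (B : I -> set R) : cancel phi psi -> uniq s ->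
    [set` s] `<=` D -> (forall i, D i -> D (phi i)) ->
    (forall i, measurable (B i)) ->
  (\prod_(i <- map phi s) P (Y i @^-1` B (psi i)) =
   P (sample id @^-1` cylinder s B))%E.
  move=> K us sD Dphi mB; rewrite sample_cylinder Yindep// big_map.
  rewrite big_seq [in RHS]big_seq; apply: eq_bigr => i si.
  by rewrite K; apply: law => //; [apply: Dphi|]; exact: sD.
have rect A B : cylinders R D A -> cylinders R D B ->
    P (sample phi1 @^-1` A `&` sample phi2 @^-1` B) =
    (P (sample id @^-1` A) * P (sample id @^-1` B))%E.
  move=> [s [B1 [sD mB1 ->]]] [s' [B2 [sD' mB2 ->]]].
  rewrite (cylinder_undup s) (cylinder_undup s').
  have {sD}sD : [set` undup s] `<=` D.
    by move=> i /=; rewrite mem_undup; exact: sD.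
  have {sD'}sD' : [set` undup s'] `<=` D.
    by move=> i /=; rewrite mem_undup; exact: sD'.
  move: (undup s) (undup s') (undup_uniq s) (undup_uniq s') sD sD' =>
    {}s {}s' us us' sD sD'.
  (* The constraint that the two relabelled cylinders put together on j. *)
  pose C j := if pselect (exists2 i, D i & phi1 i = j)
              then B1 (psi1 j) else B2 (psi2 j).
  have C1 i : D i -> C (phi1 i) = B1 i.
    move=> Di; rewrite /C; case: pselect => [ex|neg] /=; first by rewrite K1.
    by case: neg; exists i.
  have C2 i : D i -> C (phi2 i) = B2 i.
    move=> Di; rewrite /C; case: pselect => [ex|nex] /=; last by rewrite K2.
    by case: ex => j Dj /disj; case.
  rewrite -(cyl _ _ _ _ K1)// -(cyl _ _ _ _ K2)//.
  have -> : sample phi1 @^-1` cylinder s B1 `&`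
      sample phi2 @^-1` cylinder s' B2 =
     \bigcap_(j in [set` map phi1 s ++ map phi2 s']) (Y j @^-1` C j).
    apply/seteqP; split => [t [t1 t2] j /=|t tC].
    - rewrite mem_cat => /orP[] /mapP[i si ->] /=.
      + by rewrite C1; [exact: t1|exact: sD].
      + by rewrite C2; [exact: t2|exact: sD'].
    - split => i /= si.
      + rewrite -C1; last exact: sD.
        by apply: tC; rewrite /= mem_cat map_f.
      + rewrite -C2; last exact: sD'.
        by apply: tC; rewrite /= mem_cat (map_f phi2 si) orbT.
  transitivity (\prod_(j <- map phi1 s ++ map phi2 s') P (Y j @^-1` C j))%E.
    apply: Yindep.
    - rewrite cat_uniq !map_inj_uniq ?us ?us'/= ?andbT; try exact: can_inj.
      apply/hasPn => _ /mapP[i /sD' Di ->]; apply/mapP => -[j /sD Dj /esym].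
      exact: disj.
    - by move=> j; rewrite /= mem_cat => /orP[] /mapP[i si ->];
        [exact/D1/sD|exact/D2/sD'].
    - by move=> j; rewrite /C; case: ifP.
  rewrite big_cat/=; congr (_ * _)%E; rewrite !big_map big_seq [in RHS]big_seq;
    apply: eq_bigr => i si.
  - by rewrite C1 ?K1//; exact: sD.
  - by rewrite C2 ?K2//; exact: sD'.
have mS phi A : measurable A -> measurable (sample phi @^-1` A).
  by move=> mA; rewrite -[_ @^-1` _]setTI; exact: measurable_sample.
have Pfin A : measurable A -> P A \is a fin_num by exact: fin_num_measure.
move=> A B mA mB; rewrite setIC muleC.
apply: cylinder_ext => //; try exact: measurable_sample;
  [exact: mS|exact/Pfin/mS|].
move=> {mB}B cB; rewrite setIC muleC.
have mcB : @measurable _ (config R D) B by exact: sub_sigma_algebra.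
apply: cylinder_ext => //; try exact: measurable_sample;
  [exact: mS|exact/Pfin/mS|].
by move=> {mA}A cA; exact: rect.
Qed.

End ProductLaw.

(** * First passage percolation on a locally countable graph *)

Section Walks.
Context (R : realType) (G : graph).
Implicit Types (x : set G -> R) (v w : G) (p : seq G).

Lemma countable_walks v :
  locally_countable G -> countable [set p | path (@adj G) v p].
Proof.
move=> lcG.
have cn n : forall u, countable [set p | path (@adj G) u p /\ size p = n].
  elim: n => [|n IHn] u.
    apply: (@sub_countable _ _ _ [set [::]]) => //; apply: subset_card_le.
    by move=> p [_ /size0nil].
  apply: (@sub_countable _ _ _ (\bigcup_(a in [set a | adj u a])
    (cons a @` [set p | path (@adj G) a p /\ size p = n]))).
    apply: subset_card_le => -[|a p] [] //= /andP[ua ap] [sp].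
    by exists a => //; exists p.
  by apply: bigcup_countable => // a _; exact/countable_image/IHn.
apply: (@sub_countable _ _ _
  (\bigcup_(n in setT) [set p | path (@adj G) v p /\ size p = n])).
  by apply: subset_card_le => p vp; exists (size p).
by apply: bigcup_countable => // n _.
Qed.

(** The edges that can be reached from [v].  There are countably many of them,
whereas [G] may have uncountably many edges; so weights that are almost surely
nonnegative one by one are almost surely all nonnegative on these edges. *)
Definition edges_from v : set (set G) :=
  \bigcup_(p in [set p | path (@adj G) v p])
    ((fun w => [set last v p; w]) @` [set w | adj (last v p) w]).

Lemma countable_edges_from v :
  locally_countable G -> countable (edges_from v).
Proof.
move=> lcG; apply: bigcup_countable; first exact: countable_walks.
by move=> p _; exact: countable_image.
Qed.

Lemma edges_from_edges v : edges_from v `<=` @edges G.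
Proof. by move=> _ [p _ [w vw <-]]; exists (last v p), w. Qed.

Lemma path_weight_cons x v w p :
  path_weight x v (w :: p) = x [set v; w] + path_weight x w p.
Proof. by rewrite /path_weight /= big_cons. Qed.

Lemma path_weight_rcons x v p w :
  path_weight x v (rcons p w) = path_weight x v p + x [set last v p; w].
Proof.
elim: p v => [|a p IHp] v /=.
  by rewrite path_weight_cons /path_weight/= big_nil addr0 add0r.
by rewrite !path_weight_cons IHp addrA.
Qed.

Lemma path_weight_ge0 x v p : (forall e, edges_from v e -> 0 <= x e) ->
  path (@adj G) v p -> 0 <= path_weight x v p.
Proof.
move=> x0; elim/last_ind: p => [_|p w IHp].
  by rewrite /path_weight big_nil.
rewrite rcons_path path_weight_rcons => /andP[vp pw].
by rewrite addr_ge0 ?IHp// x0//; exists p => //; exists w.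
Qed.

Lemma fpp_dist_ge x v w (c : R) : (exists p, is_path v w p) ->
  (forall p, is_path v w p -> c <= path_weight x v p) -> c <= fpp_dist x v w.
Proof.
move=> [p0 vp0] cx; apply: lb_le_inf.
  by exists (path_weight x v p0), p0.
by move=> _ [p vp <-]; exact: cx.
Qed.

Lemma fpp_dist_le x v w p : (forall e, edges_from v e -> 0 <= x e) ->
  is_path v w p -> fpp_dist x v w <= path_weight x v p.
Proof.
move=> x0 vp; apply: ge_inf; last by exists p.
by exists 0 => _ [q [vq _ _] <-]; exact: path_weight_ge0.
Qed.

Lemma fpp_dist_ge0 x v w : (forall e, edges_from v e -> 0 <= x e) ->
  (exists p, is_path v w p) -> 0 <= fpp_dist x v w.
Proof.
by move=> x0 vw; apply: fpp_dist_ge => // p [vp _ _]; exact: path_weight_ge0.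
Qed.

Lemma measurable_path_weight v p : path (@adj G) v p ->
  measurable_fun setT (fun x : config R (@edges G) => path_weight x v p).
Proof.
elim: p v => [|w p IHp] v /=.
  by move=> _; rewrite /path_weight/= big_nil; exact: measurable_cst.
move=> /andP[vw wp].
have -> : (fun x : config R (@edges G) => path_weight x v (w :: p)) =
    (fun x => x [set v; w] + path_weight x w p).
  by apply/funext => x; rewrite path_weight_cons.
apply: measurable_funD; last exact: IHp.
by apply: measurable_coord; exists v, w.
Qed.

Lemma measurable_fpp_dist v w : locally_countable G ->
  measurable_fun setT (fun x : config R (@edges G) => fpp_dist x v w).
Proof.
move=> lcG.
have -> : (fun x : config R (@edges G) => fpp_dist x v w) = fine \o
    (fun x => ereal_inf ((fun p => (path_weight x v p)%:E) @` is_path v w)).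
  by apply/funext => x; rewrite /fpp_dist inf_fine image_comp.
apply: measurableT_comp => //.
apply: measurable_fun_ereal_inf_countable.
  apply: (sub_countable _ (countable_walks v lcG)).
  by apply: subset_card_le => p [].
by move=> p [vp _ _]; apply/measurable_EFinP; exact: measurable_path_weight.
Qed.

End Walks.

Section Integrability.
Context (R : realType) (G : graph).
Context (disp : measure_display) (T : measurableType disp).
Variables (P : probability T R) (Y : set G -> {RV P >-> R}).
Hypothesis lcG : locally_countable G.
Hypothesis Y0 : forall e, edges e -> {ae P, forall t, 0 <= Y e t}.
Hypothesis iY : forall e, edges e -> P.-integrable setT (EFin \o Y e).

Lemma ae_edges_from_ge0 v :
  {ae P, forall t e, edges_from v e -> 0 <= Y e t}.
Proof.
apply: ae_countable; first exact: countable_edges_from.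
by move=> e /edges_from_edges; exact: Y0.
Qed.

Lemma integrable_path_weight v p : path (@adj G) v p ->
  P.-integrable setT (fun t => (path_weight (Y ^~ t) v p)%:E).
Proof.
elim: p v => [|w p IHp] v vp.
  rewrite (_ : (fun _ => _) = cst 0%E); first exact: integrable0.
  by apply/funext => t; rewrite /path_weight/= big_nil.
move: vp => /= /andP[vw wp].
have iE : P.-integrable setT (EFin \o Y [set v; w]) by apply: iY; exists v, w.
rewrite (_ : (fun _ => _) = (EFin \o Y [set v; w]) \+
    (fun t => (path_weight (Y ^~ t) w p)%:E))%E.
  exact: integrableD (IHp _ wp).
by apply/funext => t; rewrite path_weight_cons EFinD.
Qed.

Lemma measurable_fpp_dist_sample (phi : set G -> set G) (v w : G) :
  measurable_fun setT (fun t => fpp_dist (fun e => Y (phi e) t) v w).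
Proof.
exact: (measurableT_comp (measurable_fpp_dist (R := R) v w lcG)
  (measurable_sample (D := @edges G) Y phi)).
Qed.

Lemma integrable_fpp_dist (v w : G) : (exists p, is_path v w p) ->
  P.-integrable setT (fun t => (fpp_dist (Y ^~ t) v w)%:E).
Proof.
move=> vw; have [p vp] := vw.
have mD : measurable_fun setT (fun t => fpp_dist (Y ^~ t) v w).
  exact: (measurable_fpp_dist_sample id).
have ip : P.-integrable setT (fun t => (path_weight (Y ^~ t) v p)%:E).
  by case: vp => vp _ _; exact: integrable_path_weight.
apply/integrableP; split; first exact/measurable_EFinP.
have /integrableP[mp] := ip; apply: le_lt_trans.
apply: ae_ge0_le_integral => //.
- exact/measurableT_comp/measurable_EFinP.
- exact: measurableT_comp.
apply: filterS (ae_edges_from_ge0 v) => t x0 _.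
rewrite lee_fin ger0_norm; last exact: fpp_dist_ge0.
rewrite ger0_norm; first exact: fpp_dist_le.
by apply: path_weight_ge0 => //; case: vp.
Qed.

End Integrability.

(** * Copies of the product graph at the children of the root *)

Section TreeProduct.
Context (R : realType) (d : nat) (G : graph).
Notation H := (cprod (tree d) G).
Implicit Types (i : 'I_d.-1) (v w : H) (p : seq H) (e : set H).

(** The children of a word are obtained by adding a letter in front of it, so
the words that end with [i] form the copy of the tree rooted at the child
[[:: i]] of the root. *)
Definition graft i v : H := (rcons v.1 i : tree d, v.2).

Lemma graft_inj i : injective (graft i).
Proof. by move=> [u g] [u' g'] [] /rcons_inj [-> ->]. Qed.

Lemma graft_disj i j v w : graft i v = graft j w -> i = j.
Proof. by move=> [] /rcons_inj []. Qed.

Lemma graft_neq_root i v g : graft i v != (tree_root d, g) :> H.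
Proof. by case: v => -[|a u] h; apply/eqP => -[]. Qed.

Lemma graft_adj i v w : adj v w -> adj (graft i v) (graft i w).
Proof.
have beheadE (u : seq 'I_d.-1) : u != [::] ->
  behead (rcons u i) = rcons (behead u) i by case: u.
have rconsN0 (u : seq 'I_d.-1) : rcons u i != [::] by case: u.
case: v w => [u g] [u' g'] /=; rewrite /cprod_adj/=.
move=> /orP[/andP[/eqP -> gg']|/andP[/eqP -> uu']].
  by rewrite eqxx gg'.
rewrite eqxx/=; apply/orP; right; move: uu'; rewrite /tree_adj !rconsN0/=.
by move=> /orP[/andP[u0 /eqP ->]|/andP[u0 /eqP ->]];
  rewrite (beheadE _ u0) eqxx ?orbT.
Qed.

Lemma graft_root i g : adj ((tree_root d, g) : H) (graft i (tree_root d, g)).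
Proof. by rewrite /= /cprod_adj/= /tree_adj/= !eqxx/= ?orbT. Qed.

Definition graft_edge i e : set H := graft i @` e.

Lemma graft_edge_edges i e : edges e -> edges (graft_edge i e).
Proof.
move=> [v [w [vw ->]]]; exists (graft i v), (graft i w); split.
  exact: graft_adj.
by rewrite /graft_edge image_setU !image_set1.
Qed.

Lemma graft_edgeK i : cancel (graft_edge i) (fun e => graft i @^-1` e).
Proof.
move=> e; apply/seteqP; split => [v [w ew /graft_inj <-]//|v ev].
by exists v.
Qed.

Lemma graft_edge_disj i j e f : i != j -> edges e ->
  graft_edge i e <> graft_edge j f.
Proof.
move=> /eqP ij [v [w [_ ->]]] /seteqP[+ _] => /(_ (graft i v)).
by case; [exists v => //; left|move=> v' _ /esym /graft_disj].
Qed.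

Lemma graft_path_weight i (x : set H -> R) v p :
  path_weight x (graft i v) (map (graft i) p) =
  path_weight (x \o graft_edge i) v p.
Proof.
elim: p v => [|w p IHp] v; first by rewrite /path_weight/= !big_nil.
by rewrite /= !path_weight_cons IHp /= /graft_edge image_setU !image_set1.
Qed.

Lemma graft_walk i v p : path (@adj H) v p ->
  path (@adj H) (graft i v) (map (graft i) p).
Proof.
elim: p v => //= w p IHp v /andP[vw wp].
by rewrite IHp// andbT; exact: graft_adj.
Qed.

(** Enter the copy of index [i], follow there the copy of a path, and leave.  If
[g] and [h] were equal, the root vertex would be repeated. *)
Lemma detour_path i (g h : G) p : g != h ->
  is_path ((tree_root d, g) : H) (tree_root d, h) p ->
  is_path ((tree_root d, g) : H) (tree_root d, h)
    (graft i (tree_root d, g) :: rcons (map (graft i) p) (tree_root d, h)).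
Proof.
move=> gh [gp lp up]; split.
- suff : path (@adj H) (graft i (tree_root d, g))
      (rcons (map (graft i) p) (tree_root d, h)).
    by move=> gph; apply/andP; split => //; exact: graft_root.
  by rewrite rcons_path graft_walk// last_map lp adj_sym; exact: graft_root.
- by rewrite /= last_rcons.
- have nr k q : (tree_root d, k) \notin map (graft i) q.
    by apply/mapP => -[v _ /esym/eqP]; rewrite (negbTE (graft_neq_root _ _ _)).
  have gr k v : (tree_root d, k) != graft i v by rewrite eq_sym graft_neq_root.
  rewrite /= inE mem_rcons inE !negb_or gr nr rcons_uniq nr.
  rewrite mem_rcons inE negb_or graft_neq_root.
  rewrite (mem_map (graft_inj (i := i))) map_inj_uniq; last exact: graft_inj.
  move: up => /= ->; rewrite !andbT; apply: contra gh.
  by move=> /eqP [->].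
Qed.

Lemma edges_from_graft i g e : edges_from (graft i (tree_root d, g)) e ->
  edges_from ((tree_root d, g) : H) e.
Proof.
move=> [p gp [w pw <-]]; exists (graft i (tree_root d, g) :: p).
  by rewrite /= gp andbT; exact: graft_root.
by exists w.
Qed.

Lemma edges_from_graft_edge i g e : edges_from ((tree_root d, g) : H) e ->
  edges_from ((tree_root d, g) : H) (graft_edge i e).
Proof.
move=> [p gp [w pw <-]]; apply: (@edges_from_graft i).
exists (map (graft i) p); first exact: graft_walk.
exists (graft i w) => /=; rewrite last_map; first exact: graft_adj.
by rewrite /graft_edge image_setU !image_set1.
Qed.

Definition rung i g : set H := [set (tree_root d, g); graft i (tree_root d, g)].

Lemma rung_edges i g : edges (rung i g).
Proof.
exists (tree_root d, g), (graft i (tree_root d, g)); split => //.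
exact: graft_root.
Qed.

(** Taking the infimum of the weights of the detours.  The absolute values make
the error term nonnegative everywhere. *)
Lemma fpp_dist_detour i (g h : G) (x : set H -> R) :
  (forall e, edges_from ((tree_root d, g) : H) e -> 0 <= x e) ->
  (exists p, is_path ((tree_root d, g) : H) (tree_root d, h) p) ->
  fpp_dist x ((tree_root d, g) : H) (tree_root d, h) <=
  fpp_dist (x \o graft_edge i) ((tree_root d, g) : H) (tree_root d, h) +
    (`|x (rung i g)| + `|x (rung i h)|).
Proof.
move=> x0 gh.
have x0' e : edges_from ((tree_root d, g) : H) e -> 0 <= (x \o graft_edge i) e.
  by move=> /(edges_from_graft_edge i) /x0.
(* When g = h the distance on the left is that of the empty path. *)
have [ghE|ghN] := eqVneq g h.
  have pnil : is_path ((tree_root d, g) : H) (tree_root d, h) [::].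
    by split; rewrite //= ghE.
  apply: (le_trans (fpp_dist_le x0 pnil)).
  rewrite [leLHS]/path_weight/= big_nil.
  by apply: addr_ge0; [exact: fpp_dist_ge0|rewrite addr_ge0].
rewrite -lerBlDr; apply: fpp_dist_ge => // p gp; rewrite lerBlDr.
apply: (le_trans (fpp_dist_le x0 (detour_path i ghN gp))).
have [_ lp _] := gp.
rewrite path_weight_cons path_weight_rcons graft_path_weight last_map lp.
rewrite addrCA lerD2l lerD// -/(rung i g) ?ler_norm//.
by rewrite setUC -/(rung i h) ler_norm.
Qed.

Lemma locally_countable_tree_product :
  locally_countable G -> locally_countable H.
Proof.
move=> lcG [u g].
apply: (@sub_countable _ _ _ ([set: tree d] `*` (g |` [set h | adj g h]))).
  apply: subset_card_le => -[u' h] /=; rewrite /cprod_adj/=.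
  by move=> /orP[/andP[_ gh]|/andP[/eqP <- _]]; split => //; [right|left].
apply: countableX; first exact: (@countableP (seq 'I_d.-1)).
rewrite -bigcup2E; apply: bigcup_countable => // -[|[|n]] _ //=.
Qed.

Lemma ray_path (ray : nat -> G) n : is_ray ray ->
  exists p, is_path ((tree_root d, ray 0%N) : H) (tree_root d, ray n) p.
Proof.
move=> [rinj radj]; pose r j : H := (tree_root d, ray j).
exists (map r (iota 1 n)).
have rI : injective r by move=> j k [] /rinj.
split.
- suff : forall m k, path (@adj H) (r m) (map r (iota m.+1 k)) by exact.
  move=> m k; elim: k m => //= k IHk m; rewrite IHk andbT.
  by apply/orP; left; rewrite /= radj.
- by rewrite -[(_, ray 0%N)]/(r 0%N) last_map; congr r;
    case: n => // n; rewrite -nth_last size_iota nth_iota.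
- by rewrite -[_ :: _]/(map r (iota 0 n.+1)) map_inj_uniq ?iota_uniq.
Qed.

End TreeProduct.

(** * Tightness *)

Unset Implicit Arguments.

Theorem mainTheorem2 (R : realType) (d : nat) (G : graph) (ray : nat -> G)
    (disp0 : measure_display) (T0 : measurableType disp0)
    (P0 : probability T0 R) (X : {RV P0 >-> R})
    (disp : measure_display) (T : measurableType disp)
    (P : probability T R)
    (Xe : set (cprod (tree d) G) -> {RV P >-> R}) :
  (3 <= d)%N ->
  locally_countable G ->
  is_ray ray ->
  (forall t, 0 <= X t) ->
  ('E_P0[X] < +oo)%E ->
  (forall e, edges e -> same_law (Xe e) X) ->
  mutually_independent (@edges (cprod (tree d) G)) Xe ->
  let D (n : nat) (t : T) : R :=
    @fpp_dist R (cprod (tree d) G) (fun e => Xe e t)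
      (tree_root d, ray 0%N) (tree_root d, ray n) in
  tight P (fun n t => D n t - fine 'E_P[D n]).
Proof.
move=> d3 lcG isray X0 EX law indep D.
pose H := cprod (tree d) G.
have lcH : locally_countable H by exact: locally_countable_tree_product.
have absE e : edges e -> (\int[P]_t (`|Xe e t|)%:E = 'E_P0[X])%E.
  move=> ee; transitivity (\int[distribution P (Xe e)]_y (`|y|)%:E)%E.
    rewrite ge0_integral_distribution//.
    by apply/measurable_EFinP; exact: normr_measurable.
  rewrite (@eq_measure_integral _ _ _ _ (distribution P0 X)); last first.
    by move=> A mA _; exact: law.
  rewrite ge0_integral_distribution//; last first.
    by apply/measurable_EFinP; exact: normr_measurable.
  by rewrite unlock; apply: eq_integral => t _ /=; rewrite ger0_norm.
have Xe0 e : edges e -> {ae P, forall t, 0 <= Xe e t}.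
  move=> ee; exists (Xe e @^-1` `]-oo, 0[); split.
  - by rewrite -[_ @^-1` _]setTI; exact: measurable_funP.
  - have := law e ee `]-oo, 0[%classic (measurable_itv _).
    rewrite /distribution /pushforward => ->.
    rewrite (_ : _ @^-1` _ = set0) ?measure0//.
    by apply/seteqP; split => // t /=; rewrite in_itv/= ltNge X0.
  - by move=> t /= /negP; rewrite -ltNge in_itv.
have iXe e : edges e -> P.-integrable setT (EFin \o Xe e).
  move=> ee; apply/integrableP; split; first exact/measurable_EFinP.
  by rewrite /= absE.
have EXfin : ('E_P0[X] \is a fin_num)%E.
  by rewrite ge0_fin_numE// expectation_ge0.
set mu := fine 'E_P0[X].
have d2 : (1 < d.-1)%N by rewrite ltn_predRL.
pose i0 : 'I_d.-1 := Ordinal (ltnW d2); pose i1 : 'I_d.-1 := Ordinal d2.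
pose v n : H := (tree_root d, ray n).
have vP n : exists p, is_path (v 0%N) (v n) p by exact: ray_path.
have mD n : measurable_fun setT (D n).
  exact: (measurable_fpp_dist_sample Xe lcH id).
apply: (@tight_bounded_expectation _ _ _ _ _ (8 * mu)) => n.
  exact: measurable_funB.
pose Di i t := fpp_dist (fun e => Xe (graft_edge i e) t) (v 0%N) (v n).
pose a i t : R := `|Xe (rung i (ray 0%N)) t| + `|Xe (rung i (ray n)) t|.
have ma i : measurable_fun setT (a i).
  by apply: measurable_funD; exact: measurableT_comp.
have a0 i t : 0 <= a i t by rewrite addr_ge0.
have Ea i : (\int[P]_t (a i t)%:E = (2 * mu)%:E)%E.
  rewrite /a; under eq_integral do rewrite EFinD.
  rewrite ge0_integralD//=; last 2 first.
  - by apply/measurable_EFinP; exact: measurableT_comp.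
  - by apply/measurable_EFinP; exact: measurableT_comp.
  rewrite !absE; try exact: rung_edges.
  by rewrite -(fineK EXfin) -EFinD -/mu mulr2n mulrDl !mul1r.
have EW : (\int[P]_t (a i0 t + a i1 t)%:E = (4 * mu)%:E)%E.
  under eq_integral do rewrite EFinD.
  rewrite ge0_integralD//=; last 4 first.
  - by move=> t _; rewrite lee_fin.
  - exact/measurable_EFinP.
  - by move=> t _; rewrite lee_fin.
  - exact/measurable_EFinP.
  by rewrite !Ea -EFinD; congr (_%:E); lra.
have -> : (8 * mu)%:E = (2%:E * 'E_P[fun t => (a i0 t + a i1 t)%R])%E.
  by rewrite unlock EW -EFinM; congr (_%:E); lra.
apply: (@dekking_host _ _ _ _ _ (Di i0) (Di i1)).
- exact: (integrable_fpp_dist lcH Xe0 iXe (vP n)).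
- exact: (measurable_fpp_dist_sample Xe lcH).
- exact: (measurable_fpp_dist_sample Xe lcH).
- exact: measurable_funD.
- move=> A B mA mB.
  have mfA C : measurable C -> measurable
      ((fun x : config R (@edges H) => fpp_dist x (v 0%N) (v n)) @^-1` C).
    move=> mC; rewrite -[_ @^-1` _]setTI.
    exact: (measurable_fpp_dist (R := R) (v 0%N) (v n) lcH).
  apply: (sample_indep indep (phi1 := graft_edge i0)
    (phi2 := graft_edge i1) _ _ (graft_edgeK i0) (graft_edgeK i1)
    _ _ (mfA A mA) (mfA B mB)).
  - exact: graft_edge_edges.
  - exact: graft_edge_edges.
  - by move=> e f ee _; exact: graft_edge_disj.
  - by move=> e f C ee fe mC; have := law e ee C mC; have := law f fe C mC;
      rewrite /distribution /pushforward => -> ->.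
- by move=> t; rewrite addr_ge0.
- apply: filterS (ae_edges_from_ge0 lcH Xe0 (v 0%N)) => t x0.
  have h i : D n t <= Di i t + a i t by exact: fpp_dist_detour x0 (vP n).
  have h0 := h i0; have h1 := h i1.
  rewrite -lerBlDr le_min !lerBlDr.
  by rewrite (le_trans h0) ?lerD2l ?lerDl// (le_trans h1)// lerD2l lerDr.
Qed.
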